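(* Let $1 \le q < r \le \infty$. There exist constants $A, B > 0$ depending only on $q$ and $r$ such that the following holds. Let $(X, \mathbf{P}_X)$ and $(Y, \mathbf{P}_Y)$ be finite probability spaces (with full $\sigma$-algebras), let $f : X \times Y \to \mathbf{C}$, and let $\varepsilon \in (0,1)$. Then there exist partitions $\mathcal{P}$ of $X$ and $\mathcal{Q}$ of $Y$, each with entropy at most $A\varepsilon^{-B}$, i.e. $\mathbf{H}(\mathcal{P}), \mathbf{H}(\mathcal{Q}) \le A \varepsilon^{-B}$, such that $$\left\| f - \mathbf{E}(f \mid \mathcal{P} \otimes \mathcal{Q}) \right\|_{S^r} \le \varepsilon \|f\|_{S^q}.$$
   Context: For a finite probability space $(X,\mathbf{P}_X)$ with full $\sigma$-algebra $2^X$ and a partition $\mathcal{P}$ of $X$, the (Shannon) entropy is $\mathbf{H}(\mathcal{P}) := \sum_{A \in \mathcal{P}} \mathbf{P}_X(A) \log \frac{1}{\mathbf{P}_X(A)}$ (with $0\log\frac10 := 0$). The product $X\times Y$ carries the product measure, and $\mathcal{P} \otimes \mathcal{Q} := \{A \times B : A \in \mathcal{P}, B \in \mathcal{Q}\}$. The function $\mathbf{E}(f \mid \mathcal{P}\otimes\mathcal{Q}) : X\times Y \to \mathbf{C}$ is constant on each part $A \times B$ of $\mathcal{P}\otimes\mathcal{Q}$, equal there to $\mathbf{E}[f \mathbf{1}_{A\times B}]/(\mathbf{P}_X(A)\mathbf{P}_Y(B))$ (its values on parts of probability zero are immaterial). For $f : X \times Y \to \mathbf{C}$ and $q\in[1,\infty]$,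 the Schatten norm $\|f\|_{S^q}$ is the $\ell^q$ norm (the maximum, if $q=\infty$) of the singular values of the $|X|\times|Y|$ matrix with $(x,y)$ entry $f(x,y)\sqrt{\mathbf{P}_X(x)\mathbf{P}_Y(y)}$. *)

(* Defs.v *)
From HB Require Import structures.
From mathcomp Require Import all_boot all_order all_algebra.
From mathcomp Require Import spectral sesquilinear.
From mathcomp Require Import complex.
From mathcomp Require Import all_classical all_reals all_analysis.

Set Implicit Arguments.
Unset Strict Implicit.
Unset Printing Implicit Defensive.

Import Order.TTheory GRing.Theory Num.Theory.

Local Open Scope ring_scope.
Local Open Scope complex_scope.
Local Open Scope sesquilinear_scope.

Section FiniteProbability.
Variable R : realType.

Definition is_prob (X : finType) (PX : X -> R) : Prop :=
  (forall x, 0 <= PX x) /\ \sum_(x : X) PX x = 1.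

Definition prob (X : finType) (PX : X -> R) (A : {set X}) : R :=
  \sum_(x in A) PX x.

(* The convention 0 log (1/0) = 0 holds because the first factor vanishes. *)
Definition entropy (X : finType) (PX : X -> R) (P : {set {set X}}) : R :=
  \sum_(A in P) prob PX A * ln (prob PX A)^-1.

(* E(f | P (x) Q); the value on a part of probability zero is 0, since
   0^-1 = 0. *)
Definition cond_exp (X Y : finType) (PX : X -> R) (PY : Y -> R)
    (f : X * Y -> R[i]) (P : {set {set X}}) (Q : {set {set Y}}) :
    X * Y -> R[i] :=
  fun z =>
    let A := finset.pblock P z.1 in
    let B := finset.pblock Q z.2 in
    (\sum_(x in A) \sum_(y in B) (PX x * PY y)%:C * f (x, y))
      / (prob PX A * prob PY B)%:C.

(* Square roots of the eigenvalues of M^* M, with multiplicity; M^* M is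
   Hermitian positive semidefinite, so these eigenvalues are real and
   nonnegative. When n > m this family contains n - m additional zeros, which
   do not affect the l^q norms. *)
Definition singular_values (m n : nat) (M : 'M[R[i]]_(m, n)) : 'rV[R]_n :=
  \row_(j < n) Num.sqrt (complex.Re (spectral_diag (M ^t* *m M) 0 j)).

(* Meant for 1 <= q <= +oo; the value at -oo is a dummy. *)
Definition lq_norm (n : nat) (q : \bar R) (s : 'rV[R]_n) : R :=
  match q with
  | q'%:E => (\sum_(j < n) `|s 0 j| `^ q') `^ q'^-1
  | +oo%E => \big[Num.max/0]_(j < n) `|s 0 j|
  | -oo%E => 0
  end.

Definition weighted_mx (X Y : finType) (PX : X -> R) (PY : Y -> R)
    (f : X * Y -> R[i]) : 'M[R[i]]_(#|X|, #|Y|) :=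
  \matrix_(i < #|X|, j < #|Y|)
    (f (enum_val i, enum_val j)
     * (Num.sqrt (PX (enum_val i) * PY (enum_val j)))%:C).

Definition schatten_norm (X Y : finType) (PX : X -> R) (PY : Y -> R)
    (q : \bar R) (f : X * Y -> R[i]) : R :=
  lq_norm q (singular_values (weighted_mx PX PY f)).

End FiniteProbability.

(* Main.v *)
Require Import Defs.
From HB Require Import structures.
From mathcomp Require Import all_boot all_order all_algebra.
From mathcomp Require Import spectral sesquilinear.
From mathcomp Require Import complex.
From mathcomp Require Import all_classical all_reals all_analysis.
From mathcomp Require Import ring lra.

Set Implicit Arguments.
Unset Strict Implicit.
Unset Printing Implicit Defensive.

Import Order.TTheory GRing.Theory Num.Theory.

Local Open Scope ring_scope.

(* Conditioning on [P (x) Q] compresses the weighted matrix [M] of [f] to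
   [E *m M *m E'], where [E] and [E'] are orthogonal projections.  Truncating
   the singular value decomposition of [M] at level [d * S], with [S] the
   [S^q] norm of [f], leaves a part of operator norm at most [d * S] and at most
   [d ^ - q] singular vectors.  A unit vector is turned by rounding its values
   to multiples of [eta] into a step function at distance O(eta), and the
   partition into level sets has entropy O(1 / eta) by Gibbs' inequality, so the
   remaining part survives conditioning on the common refinements up to a small
   error.  Hence [M - E *m M *m E'] has operator norm O(d * S).  Its [S^q] norm
   is O(S) since its singular values are controlled by those of [M], and
   interpolating between the two norms gives the [S^r] bound. *)

(** * Euclidean norm, operator bounds and orthogonal projections *)

Section EuclideanNorm.
Variable C : numClosedFieldType.
Local Open Scope sesquilinear_scope.

Lemma trmxCB m n (A B : 'M[C]_(m, n)) : (A - B) ^t* = A ^t* - B ^t*.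
Proof. by apply/matrixP => i j; rewrite !mxE rmorphB. Qed.

Lemma trmxC_mul m n p (A : 'M[C]_(m, n)) (B : 'M[C]_(n, p)) :
  (A *m B) ^t* = B ^t* *m A ^t*.
Proof. by rewrite trmx_mul map_mxM. Qed.

(** Values in [C] keep norms, singular values and their bounds in one type; [singular_valuesE]
    returns to the real order. *)
Definition vnorm n (v : 'cV[C]_n) : C := sqrtC (dotmx v^T v^T).

Lemma dotmxT n (u v : 'cV[C]_n) : dotmx u^T v^T = \sum_i u i 0 * (v i 0)^*.
Proof. by rewrite dotmxE !mxE; apply: eq_bigr => i _; rewrite !mxE. Qed.

Lemma vnorm_sqr n (v : 'cV[C]_n) : vnorm v ^+ 2 = \sum_i `|v i 0| ^+ 2.
Proof. by rewrite sqrtCK dotmxT; apply: eq_bigr => i _; rewrite normCK. Qed.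

Lemma vnorm_sqr_mx n (v : 'cV[C]_n) : vnorm v ^+ 2 = (v ^t* *m v) 0 0.
Proof.
rewrite vnorm_sqr mxE; apply: eq_bigr => i _.
by rewrite !mxE normCK mulrC.
Qed.

Lemma vnorm_ge0 n (v : 'cV[C]_n) : 0 <= vnorm v.
Proof. by rewrite sqrtC_ge0 dnorm_ge0. Qed.

Lemma vnorm_le n m (u : 'cV[C]_n) (v : 'cV[C]_m) :
  (vnorm u <= vnorm v) = (vnorm u ^+ 2 <= vnorm v ^+ 2).
Proof. by rewrite ler_sqr// nnegrE vnorm_ge0. Qed.

Lemma vnorm0 n : vnorm (0 : 'cV[C]_n) = 0.
Proof.
apply/eqP; rewrite -sqrf_eq0 vnorm_sqr big1// => i _.
by rewrite mxE normr0 expr0n.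
Qed.

Lemma vnorm_eq0 n (v : 'cV[C]_n) : vnorm v = 0 -> v = 0.
Proof.
move=> v0; have := vnorm_sqr v; rewrite v0 expr0n /= => /esym/eqP.
rewrite psumr_eq0 => [/allP v1|i _]; last exact: exprn_ge0.
apply/matrixP => i j; rewrite (ord1 j) mxE.
have /implyP/(_ isT) := v1 i (mem_index_enum _).
by rewrite expf_eq0 normr_eq0 => /eqP.
Qed.

Lemma vnormD n (u v : 'cV[C]_n) : vnorm (u + v) <= vnorm u + vnorm v.
Proof. by rewrite /vnorm linearD; apply: triangle_lerif. Qed.

Lemma vnormZ n a (v : 'cV[C]_n) : vnorm (a *: v) = `|a| * vnorm v.
Proof.
apply/eqP; rewrite -(@eqrXn2 _ 2%N)// ?mulr_ge0 ?vnorm_ge0// exprMn !vnorm_sqr.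
by apply/eqP; rewrite mulr_sumr; apply: eq_bigr => i _; rewrite mxE normrM exprMn.
Qed.

Lemma vnormN n (v : 'cV[C]_n) : vnorm (- v) = vnorm v.
Proof. by rewrite -scaleN1r vnormZ normrN1 mul1r. Qed.

Lemma CauchySchwarz_mx n (u v : 'cV[C]_n) :
  `|(u ^t* *m v) 0 0| <= vnorm u * vnorm v.
Proof.
have : `|dotmx v^T u^T| <= vnorm v * vnorm u.
  by apply: CauchySchwarz_sqrt.
rewrite mulrC dotmxT mxE; congr (`|_| <= _).
by apply: eq_bigr => i _; rewrite !mxE mulrC.
Qed.

Definition opbound m n (A : 'M[C]_(m, n)) (s : C) :=
  forall z : 'cV_n, vnorm (A *m z) <= s * vnorm z.

Lemma opboundD m n (A B : 'M[C]_(m, n)) s t :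
  opbound A s -> opbound B t -> opbound (A + B) (s + t).
Proof.
move=> As Bt z; rewrite mulmxDl mulrDl.
exact: le_trans (vnormD _ _) (lerD (As z) (Bt z)).
Qed.

Lemma opboundN m n (A : 'M[C]_(m, n)) s : opbound A s -> opbound (- A) s.
Proof. by move=> As z; rewrite mulNmx vnormN. Qed.

Lemma opboundM m n p (A : 'M[C]_(m, n)) (B : 'M[C]_(n, p)) s t :
  0 <= s -> opbound A s -> opbound B t -> opbound (A *m B) (s * t).
Proof.
move=> s0 As Bt z; rewrite -mulmxA -mulrA (le_trans (As _))//.
by rewrite ler_wpM2l.
Qed.

Lemma opbound_le m n (A : 'M[C]_(m, n)) s t :
  s <= t -> opbound A s -> opbound A t.
Proof.
by move=> st As z; rewrite (le_trans (As z))// ler_wpM2r// vnorm_ge0.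
Qed.

Lemma opbound_sum m n (I : finType) (P : pred I) (F : I -> 'M[C]_(m, n)) s :
  (forall i, P i -> opbound (F i) (s i)) ->
  opbound (\sum_(i | P i) F i) (\sum_(i | P i) s i).
Proof.
move=> Fs; elim/big_ind2: _ => [z|A a B b|//]; last exact: opboundD.
by rewrite mul0mx vnorm0 mul0r.
Qed.

Lemma opbound_rank1 m n (u : 'cV[C]_m) (v : 'cV[C]_n) :
  opbound (u *m v ^t*) (vnorm u * vnorm v).
Proof.
move=> z; rewrite -mulmxA [_ *m z]mx11_scalar mul_mx_scalar vnormZ mulrC -mulrA.
by rewrite ler_wpM2l ?vnorm_ge0// CauchySchwarz_mx.
Qed.

Definition orthoproj n (E : 'M[C]_n) := E ^t* = E /\ E *m E = E.

(** Both cross terms equal [z ^t* *m E *m z], because [E] is self-adjoint and idempotent. *)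
Lemma orthoproj_pythagoras n (E : 'M[C]_n) (z : 'cV[C]_n) : orthoproj E ->
  vnorm z ^+ 2 = vnorm (E *m z) ^+ 2 + vnorm (z - E *m z) ^+ 2.
Proof.
case=> Eh EE; rewrite !vnorm_sqr_mx.
have -> : (E *m z) ^t* *m (E *m z) = z ^t* *m E *m z.
  by rewrite trmxC_mul Eh !mulmxA -[_ *m E *m E]mulmxA EE.
have -> : (z - E *m z) ^t* *m (z - E *m z) = z ^t* *m z - z ^t* *m E *m z.
  rewrite trmxCB trmxC_mul Eh mulmxBr !mulmxBl !mulmxA.
  by rewrite -[_ *m E *m E]mulmxA EE subrr subr0.
by rewrite [X in _ = _ + X]mxE [X in _ = _ + (_ + X)]mxE addrC subrK.
Qed.

Lemma orthoproj_contract n (E : 'M[C]_n) : orthoproj E -> opbound E 1.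
Proof.
move=> Eo z; rewrite mul1r vnorm_le (orthoproj_pythagoras z Eo) lerDl.
by rewrite exprn_ge0 ?vnorm_ge0.
Qed.

Lemma orthoprojC n (E : 'M[C]_n) : orthoproj E -> orthoproj (1%:M - E).
Proof.
move=> [Eh EE]; split.
  by rewrite trmxCB Eh trmx1 map_mx1.
by rewrite mulmxBl mul1mx mulmxBr mulmx1 EE subrr subr0.
Qed.

Lemma opbound_compress m n (A : 'M[C]_(m, n)) E E' t : 0 <= t ->
  orthoproj E -> orthoproj E' -> opbound A t ->
  opbound (A - E *m A *m E') (t *+ 2).
Proof.
move=> t0 Eo Eo' At; rewrite mulr2n; apply/opboundD/opboundN => //.
have := opboundM _ (opboundM _ (orthoproj_contract Eo) At)
  (orthoproj_contract Eo').
by rewrite mul1r mulr1; apply.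
Qed.

End EuclideanNorm.

(** * Singular values: truncation, rank and compression *)

Section SingularValues.
Variable C : numClosedFieldType.
Local Open Scope sesquilinear_scope.

Section OneMatrix.
Variables (m n : nat) (M : 'M[C]_(m, n)).

Let U := spectralmx (M ^t* *m M).
Let d := spectral_diag (M ^t* *m M).

Definition sing_val (j : 'I_n) : C := sqrtC (d 0 j).

(** Right singular vectors: since [M ^t* *m M = U ^t* *m diag_mx d *m U], the columns of [U ^t*]
    form an orthonormal eigenbasis. *)
Definition sing_vec (j : 'I_n) : 'cV[C]_n := U ^t* *m delta_mx j 0.

Let mulUU : U *m U ^t* = 1%:M.
Proof. exact/unitarymxP/spectral_unitarymx. Qed.

Let mulUU' : U ^t* *m U = 1%:M.
Proof. exact: mulmx1C mulUU. Qed.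

Lemma gram_spectral : M ^t* *m M = U ^t* *m diag_mx d *m U.
Proof.
rewrite -(invmx_unitary (spectral_unitarymx _)).
apply/orthomx_spectralP/hermitian_normalmx/is_hermitianmxP.
by rewrite expr0 scale1r trmxC_mul trmxCK.
Qed.

Lemma vnorm_spectralmx z : vnorm (U *m z) = vnorm z.
Proof.
apply/eqP; rewrite -(@eqrXn2 _ 2%N)// ?vnorm_ge0//.
by rewrite !vnorm_sqr_mx trmxC_mul mulmxA -[_ *m U]mulmxA mulUU' mulmx1.
Qed.

Lemma vnorm_mulmx_spectral z :
  vnorm (M *m z) ^+ 2 = \sum_j d 0 j * `|(U *m z) j 0| ^+ 2.
Proof.
rewrite vnorm_sqr_mx trmxC_mul mulmxA -[_ *m M]mulmxA gram_spectral.
rewrite !mulmxA -trmxC_mul -mulmxA; move: (U *m z) => w.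
rewrite mxE; apply: eq_bigr => j _.
by rewrite mul_mx_diag !mxE normCK mulrAC mulrC [_ * w j 0]mulrC.
Qed.

Lemma spectralmx_sing_vec j : U *m sing_vec j = delta_mx j 0.
Proof. by rewrite mulmxA mulUU mul1mx. Qed.

Lemma sing_vec_dot j z : (sing_vec j) ^t* *m z = ((U *m z) j 0)%:M.
Proof.
rewrite trmxC_mul trmxCK -mulmxA [LHS]mx11_scalar; congr (_%:M).
rewrite mxE (bigD1 j)//= big1 ?addr0 => [|i ij].
  by rewrite !mxE !eqxx rmorph1 mul1r.
by rewrite !mxE (negPf ij) rmorph0 mul0r.
Qed.

Lemma vnorm_sing_vec j : vnorm (sing_vec j) = 1.
Proof.
rewrite -vnorm_spectralmx spectralmx_sing_vec.
apply/eqP; rewrite -(@eqrXn2 _ 2%N)// ?vnorm_ge0// expr1n vnorm_sqr.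
rewrite (bigD1 j)//= big1 ?mxE ?eqxx ?normr1 ?expr1n ?addr0// => i ij.
by rewrite mxE (negPf ij) normr0 expr0n.
Qed.

Let vnorm_mulmx_sing_vec_sqr j : vnorm (M *m sing_vec j) ^+ 2 = d 0 j.
Proof.
rewrite vnorm_mulmx_spectral spectralmx_sing_vec (bigD1 j)//= big1 => [|i ij].
  by rewrite mxE !eqxx normr1 expr1n mulr1 addr0.
by rewrite mxE (negPf ij) normr0 expr0n mulr0.
Qed.

Lemma spectral_diag_gram_ge0 j : 0 <= d 0 j.
Proof. by rewrite -vnorm_mulmx_sing_vec_sqr exprn_ge0 ?vnorm_ge0. Qed.

Lemma sing_val_ge0 j : 0 <= sing_val j.
Proof. by rewrite sqrtC_ge0 spectral_diag_gram_ge0. Qed.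

Lemma sing_val_sqr j : sing_val j ^+ 2 = d 0 j.
Proof. exact: sqrtCK. Qed.

Lemma vnorm_mulmx_sing_vec j : vnorm (M *m sing_vec j) = sing_val j.
Proof.
apply/eqP; rewrite -(@eqrXn2 _ 2%N)// ?vnorm_ge0 ?sing_val_ge0//.
by rewrite sing_val_sqr vnorm_mulmx_sing_vec_sqr.
Qed.

Lemma gram_sing_vec j :
  M ^t* *m M *m sing_vec j = sing_val j ^+ 2 *: sing_vec j.
Proof.
rewrite gram_spectral -mulmxA spectralmx_sing_vec -mulmxA scalemxAr.
congr (_ *m _); apply/matrixP => i k; rewrite mul_diag_mx !mxE sing_val_sqr.
by case: eqP => [->|_] //; rewrite !mulr0.
Qed.

(** Singular value decomposition cut at level [t]. The product [M *m sing_vec j] stands for the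
    singular value times the left singular vector. *)
Definition sing_trunc (t : C) : 'M[C]_(m, n) :=
  \sum_(j | t < sing_val j) (M *m sing_vec j) *m (sing_vec j) ^t*.

Lemma mxrank_sing_trunc t :
  (\rank (sing_trunc t) <= #|[set j | (t < sing_val j)%R]|)%N.
Proof.
rewrite -sum1dep_card /sing_trunc.
elim/big_ind2: _ => [|A a B b Aa Bb|j _]; first by rewrite mxrank0.
  exact: leq_trans (mxrank_add _ _) (leq_add Aa Bb).
by rewrite (leq_trans (mxrankM_maxr _ _))// rank_leq_row.
Qed.

(** The difference acts on [z] as [M] acts on [z - w], where [w] collects the components of [z]
    along the singular vectors above level [t]; the eigenvalues that remain are at most [t ^+ 2]. *)
Lemma opbound_sing_trunc t : 0 <= t -> opbound (M - sing_trunc t) t.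
Proof.
move=> t0 z.
pose w := \sum_(j | t < sing_val j) (U *m z) j 0 *: sing_vec j.
have -> : (M - sing_trunc t) *m z = M *m (z - w).
  rewrite mulmxBl mulmxBr; congr (_ - _).
  rewrite mulmx_suml mulmx_sumr; apply: eq_bigr => j _.
  by rewrite -!mulmxA sing_vec_dot mul_mx_scalar -scalemxAr.
have wE j : (U *m (z - w)) j 0 = if t < sing_val j then 0 else (U *m z) j 0.
  rewrite mulmxBr mxE [X in _ + X]mxE.
  have -> : (U *m w) j 0 = \sum_(i | t < sing_val i) (U *m z) i 0 * (i == j)%:R.
    rewrite mulmx_sumr summxE; apply: eq_bigr => i _.
    by rewrite -scalemxAr spectralmx_sing_vec !mxE eqxx andbT eq_sym.
  case: ifPn => tj.
    rewrite (bigD1 j)//= eqxx mulr1 big1 ?addr0 ?subrr// => i /andP[_ /negPf->].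
    by rewrite mulr0.
  rewrite big1 ?subr0// => i ti; case: eqP => [ij|_]; last by rewrite mulr0.
  by rewrite -ij ti in tj.
rewrite -(vnorm_spectralmx z) -(@ler_sqr _ _ _) ?nnegrE ?mulr_ge0 ?vnorm_ge0//.
rewrite vnorm_mulmx_spectral exprMn vnorm_sqr mulr_sumr.
apply: ler_sum => j _; rewrite wE; case: ifPn => tj.
  by rewrite normr0 expr0n mulr0 mulr_ge0// exprn_ge0.
rewrite ler_wpM2r ?exprn_ge0// -sing_val_sqr ler_sqr ?nnegrE ?sing_val_ge0//.
by rewrite real_leNgt ?ger0_real ?sing_val_ge0.
Qed.

(* If more than [\rank F] singular values of [M] exceeded [t], the span of the
   corresponding singular vectors would meet the kernel of [F], where [M] is
   bounded by [t]. *)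
Lemma card_sing_val_gt (F : 'M[C]_(m, n)) t : 0 <= t -> opbound (M - F) t ->
  (#|[set j | (t < sing_val j)%R]| <= \rank F)%N.
Proof.
move=> t0 MFt; set J := [set j | _].
pose V : 'M[C]_(#|J|, n) := \matrix_(i, k) sing_vec (enum_val i) k 0.
(* Independent rows of [V *m F^T] make [#|J|] a rank, at most that of [F]. A combination [b] that it
   kills gives a vector [z] in the kernel of [F]. *)
suff /eqP <- : row_free (V *m F^T).
  by rewrite -(mxrank_tr F) mxrankM_maxr.
apply: inj_row_free => b bVF.
pose z := (b *m V)^T.
have Fz : F *m z = 0 by rewrite -[F]trmxK -trmx_mul -mulmxA bVF trmx0.
have zE : z = \sum_(i < #|J|) b 0 i *: sing_vec (enum_val i).
  apply/matrixP => k l; rewrite (ord1 l) !mxE summxE.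
  by apply: eq_bigr => i _; rewrite !mxE.
have Uz j : (U *m z) j 0 = \sum_(i < #|J|) b 0 i * (enum_val i == j)%:R.
  rewrite zE mulmx_sumr summxE; apply: eq_bigr => i _.
  by rewrite -scalemxAr spectralmx_sing_vec !mxE eqxx andbT eq_sym.
have UzJ i : (U *m z) (enum_val i) 0 = b 0 i.
  rewrite Uz (bigD1 i)//= eqxx mulr1 big1 ?addr0// => k ki.
  by rewrite (inj_eq enum_val_inj) (negPf ki) mulr0.
have UzNJ j : j \notin J -> (U *m z) j 0 = 0.
  move=> jJ; rewrite Uz big1// => i _; case: eqP => [ij|_]; last first.
    by rewrite mulr0.
  by rewrite -ij enum_valP in jJ.
have : vnorm (M *m z) ^+ 2 <= (t * vnorm (U *m z)) ^+ 2.
  rewrite ler_sqr ?nnegrE ?mulr_ge0 ?vnorm_ge0// vnorm_spectralmx.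
  by have := MFt z; rewrite mulmxBl Fz subr0.
rewrite exprMn vnorm_mulmx_spectral vnorm_sqr mulr_sumr -subr_le0 -sumrB.
(* Off [J] the coordinates of [z] vanish, and on [J] the eigenvalue exceeds [t ^+ 2]. A nonpositive
   sum thus makes every term zero, and strictness on [J] gives [b = 0]. *)
have term_ge0 j : 0 <= d 0 j * `|(U *m z) j 0| ^+ 2 - t ^+ 2 * `|(U *m z) j 0| ^+ 2.
  rewrite -mulrBl; have [jJ|/UzNJ->] := boolP (j \in J); last first.
    by rewrite normr0 expr0n mulr0.
  rewrite mulr_ge0 ?exprn_ge0// subr_ge0 -sing_val_sqr ler_sqr ?nnegrE//.
    by move: jJ; rewrite inE => /ltW.
  exact: sing_val_ge0.
move=> sum_le0; have /eqP : \sum_j (d 0 j * `|(U *m z) j 0| ^+ 2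
    - t ^+ 2 * `|(U *m z) j 0| ^+ 2) = 0.
  by apply/le_anti; rewrite sum_le0 sumr_ge0.
rewrite psumr_eq0 => [/allP term0|j _]; last exact: term_ge0.
apply/rowP => i; rewrite mxE -UzJ.
have /implyP/(_ isT) := term0 (enum_val i) (mem_index_enum _).
rewrite -mulrBl mulf_eq0 expf_eq0 normr_eq0 /= => /orP[|/eqP//].
rewrite -sing_val_sqr subr_eq0 eqrXn2 ?sing_val_ge0// => /eqP tE.
by have := enum_valP i; rewrite inE tE ltxx.
Qed.

End OneMatrix.

(* [M] is within [t] of its truncation [F], hence [M - E *m M *m E'] is within
   [2 t] of [F - E *m F *m E'], whose rank is at most twice that of [F]. *)
Lemma card_sing_val_compress m n (M : 'M[C]_(m, n)) E E' t : 0 <= t ->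
  orthoproj E -> orthoproj E' ->
  (#|[set j | (t *+ 2 < sing_val (M - E *m M *m E') j)%R]|
    <= (#|[set j | (t < sing_val M j)%R]|).*2)%N.
Proof.
move=> t0 Eo Eo'; pose F := sing_trunc M t.
have rF : (\rank (F - E *m F *m E')%R <= (#|[set j | (t < sing_val M j)%R]|).*2)%N.
  rewrite (leq_trans (mxrank_add _ _))// -addnn leq_add ?mxrank_sing_trunc//.
  rewrite mxrank_opp (leq_trans (mxrankM_maxl _ _))//.
  by rewrite (leq_trans (mxrankM_maxr _ _))// mxrank_sing_trunc.
apply: leq_trans (card_sing_val_gt _ _) rF; first by rewrite mulrn_wge0.
have -> : M - E *m M *m E' - (F - E *m F *m E') = (M - F) - E *m (M - F) *m E'.
  by rewrite mulmxBr mulmxBl !opprB addrACA [in RHS]addrACA [- F + _]addrC.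
exact: opbound_compress t0 Eo Eo' (opbound_sing_trunc M t0).
Qed.

(** The truncation error costs [2 t]. Each kept term, with [a = M v], splits as [a v^* - E a (E'
    v)^* = (a - E a) v^* + E a (v - E' v)^*], so only the averaging errors of [a] and [v] enter. *)
Lemma opbound_sing_compress m n (M : 'M[C]_(m, n)) E E' t : 0 <= t ->
  orthoproj E -> orthoproj E' ->
  opbound (M - E *m M *m E')
    (t *+ 2 + \sum_(j | t < sing_val M j)
      (vnorm (M *m sing_vec M j - E *m (M *m sing_vec M j))
       + sing_val M j * vnorm (sing_vec M j - E' *m sing_vec M j))).
Proof.
move=> t0 Eo Eo'; pose F := sing_trunc M t.
have -> : M - E *m M *m E' =
    (M - F) - E *m (M - F) *m E' + (F - E *m F *m E').
  by rewrite mulmxBr mulmxBl opprB [RHS]addrC addrACA addKr [F + _]addrC subrK.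
apply: opboundD.
  exact: opbound_compress t0 Eo Eo' (opbound_sing_trunc M t0).
have -> : F - E *m F *m E' = \sum_(j | t < sing_val M j)
   ((M *m sing_vec M j - E *m (M *m sing_vec M j)) *m (sing_vec M j) ^t*
    + (E *m (M *m sing_vec M j)) *m (sing_vec M j - E' *m sing_vec M j) ^t*).
  rewrite mulmx_sumr mulmx_suml -sumrB; apply: eq_bigr => j _.
  rewrite trmxCB [(E' *m _) ^t*]trmxC_mul (proj1 Eo') mulmxBl mulmxBr.
  by rewrite !mulmxA addrA subrK.
apply: opbound_sum => j _; apply: opboundD.
  by have := opbound_rank1 (M *m sing_vec M j - E *m (M *m sing_vec M j))
    (sing_vec M j); rewrite vnorm_sing_vec mulr1.
apply: opbound_le (opbound_rank1 _ _).
rewrite ler_wpM2r ?vnorm_ge0// -vnorm_mulmx_sing_vec.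
by have := orthoproj_contract Eo (M *m sing_vec M j); rewrite mul1r.
Qed.

End SingularValues.

(** Turns a comparison of counting functions into one of sums, later of [q]-th powers. Largest
    values are matched: the hypothesis at [t = b j0] forces [a i0 <= b j0], and induction removes
    both. *)
Lemma ler_sum_card_gt (R : realDomainType) (I J : finType) (A : {set I})
    (B : {set J}) (a : I -> R) (b : J -> R) (phi : R -> R) :
  (forall i, 0 <= a i) -> (forall j, 0 <= b j) ->
  phi 0 = 0 -> {in Num.nneg &, {homo phi : x y / x <= y}} ->
  (forall t, 0 <= t ->
    (#|[set i in A | (t < a i)%R]| <= #|[set j in B | (t < b j)%R]|)%N) ->
  \sum_(i in A) phi (a i) <= \sum_(j in B) phi (b j).
Proof.
move=> a0 b0 phi0 phi_le.
have phi_ge0 x : 0 <= x -> 0 <= phi x.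
  by move=> x0; rewrite -phi0 phi_le ?nnegrE.
have [n] := ubnP #|A|; elim: n A B => // n IHn A B; rewrite ltnS => An AB.
have [->|/set0Pn[i iA]] := eqVneq A finset.set0.
  by rewrite big_set0 sumr_ge0// => j _; rewrite phi_ge0.
have [i0 i0A i0max] : exists2 i0, i0 \in A & forall i, i \in A -> a i <= a i0.
  by case: (arg_maxP a iA) => i0 ? ?; exists i0.
have [ai0|ai0] := leP (a i0) 0.
  rewrite big1 => [|k kA]; first by rewrite sumr_ge0// => j _; rewrite phi_ge0.
  suff -> : a k = 0 by [].
  by apply/le_anti; rewrite a0 (le_trans (i0max _ kA)).
have i0t t : t < a i0 -> i0 \in [set i in A | t < a i] by rewrite !inE i0A.
have [j jB] : exists j, j \in B.
  have /card_gt0P[j] : (0 < #|[set j in B | (0 < b j)%R]|)%N.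
    apply: leq_trans (AB 0 (lexx _)); apply/card_gt0P.
    by exists i0; apply: i0t.
  by rewrite inE => /andP[jB _]; exists j.
have [j0 j0B j0max] : exists2 j0, j0 \in B & forall j, j \in B -> b j <= b j0.
  by case: (arg_maxP b jB) => j0 ? ?; exists j0.
have a_le_b : a i0 <= b j0.
  rewrite leNgt; apply/negP => ba.
  have := AB _ (b0 j0); rewrite [X in (_ <= X)%N](_ : _ = 0%N); last first.
    apply/eqP; rewrite cards_eq0; apply/eqP/setP => k; rewrite !inE.
    by apply/negP => /andP[/j0max]; rewrite leNgt => /negP.
  by rewrite leqn0 cards_eq0 => /eqP/setP/(_ i0); rewrite i0t// inE.
rewrite (big_setD1 i0)//= [leRHS](big_setD1 j0)//= lerD//.
  by rewrite phi_le ?nnegrE.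
apply: IHn => [|t t0].
  by move: An; rewrite (cardsD1 i0 A) i0A.
have sD (T : finType) (D : {set T}) (c : T -> R) x :
    [set i in D :\ x | t < c i] = [set i in D | t < c i] :\ x.
  by apply/setP => y; rewrite !inE andbA.
(* For [t < a i0] both counts drop by exactly one; otherwise nothing remains to be counted on the
   left. *)
have [ta|ta] := ltP t (a i0).
  have := AB t t0; rewrite (cardsD1 i0) i0t// (cardsD1 j0 [set j in B | _]).
  by rewrite inE j0B (lt_le_trans ta a_le_b) !sD.
rewrite [X in (X <= _)%N](_ : _ = 0%N)//; apply/eqP; rewrite cards_eq0.
apply/eqP/setP => k; rewrite !inE; apply/negP => /andP[/andP[_ /i0max kA]].
by rewrite ltNge (le_trans kA ta).
Qed.

(** * Bounds for the real singular values of a compression error *)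

Section RealSingularValues.
Variable R : realType.
Local Open Scope complex_scope.
Local Open Scope sesquilinear_scope.
Variables m n : nat.
Implicit Type M : 'M[R[i]]_(m, n).

(** The eigenvalues are nonnegative, so taking real parts loses nothing and the results over [C]
    transfer. *)
Lemma singular_valuesE M j : (singular_values M 0 j)%:C = sing_val M j.
Proof.
have d0 := spectral_diag_gram_ge0 M j.
apply/eqP; rewrite -(@eqrXn2 _ 2%N)// ?sing_val_ge0//; last first.
  by rewrite ler0c mxE sqrtr_ge0.
rewrite sing_val_sqr mxE -rmorphXn /= sqr_sqrtr; last first.
  by rewrite -ler0c RRe_real ?ger0_real.
by rewrite RRe_real ?ger0_real.
Qed.

Lemma singular_values_ge0 M j : 0 <= singular_values M 0 j.
Proof. by rewrite mxE sqrtr_ge0. Qed.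

(** The rank bound [card_sing_val_gt] with [F = 0] leaves no singular value above [s]. *)
Lemma singular_values_le M s j : 0 <= s -> opbound M s%:C ->
  singular_values M 0 j <= s.
Proof.
move=> s0 Ms; rewrite leNgt; apply/negP => sM.
have := @card_sing_val_gt _ _ _ M 0 s%:C; rewrite subr0 mxrank0 ler0c leqn0.
move=> /(_ s0 Ms); rewrite cards_eq0 => /eqP/setP/(_ j).
by rewrite !inE -singular_valuesE ltcR sM.
Qed.

(** By [card_sing_val_compress] the counting function on the left is dominated by that of two
    copies, indexed by [bool], of the doubled singular values of [M]. The copies account for a
    factor [2] and the doubling for [2 ^ q]. *)
Lemma sum_singular_values_compress (q : R) M E E' : 0 < q ->
  orthoproj E -> orthoproj E' ->
  \sum_j singular_values (M - E *m M *m E') 0 j `^ q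
    <= 2 `^ (q + 1) * \sum_j singular_values M 0 j `^ q.
Proof.
move=> q0 Eo Eo'.
set g := singular_values _; set s := singular_values M.
have -> : 2 `^ (q + 1) * \sum_j s 0 j `^ q =
    \sum_(p : 'I_n * bool) (s 0 p.1 * 2) `^ q.
  rewrite powRD ?powRr1//; last by apply/implyP => _; rewrite pnatr_eq0.
  rewrite -(pair_bigA _ (fun i (b : bool) => (s 0 i * 2) `^ q))/= mulr_sumr.
  apply: eq_bigr => j _.
  rewrite sumr_const card_bool powRM ?singular_values_ge0//.
  by rewrite -mulr_natr mulrC; ring.
have -> : \sum_j g 0 j `^ q = \sum_(j in [set: 'I_n]) g 0 j `^ q.
  by apply: eq_bigl => j; rewrite inE.
have -> : \sum_(p : 'I_n * bool) (s 0 p.1 * 2) `^ q =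
   \sum_(p in [set: 'I_n * bool]) (s 0 p.1 * 2) `^ q.
  by apply: eq_bigl => j; rewrite inE.
apply: (@ler_sum_card_gt _ _ _ _ _ _ (fun p : 'I_n * bool => s 0 p.1 * 2)
  (fun x => x `^ q)) => [j|p|||t t0].
- exact: singular_values_ge0.
- by rewrite mulr_ge0 ?singular_values_ge0.
- by rewrite powR0// gt_eqF.
- by move=> x y x0 y0 xy; rewrite ge0_ler_powR// ltW.
have := @card_sing_val_compress _ _ _ M E E' (t / 2)%:C.
rewrite ler0c divr_ge0// => /(_ isT Eo Eo').
rewrite -rmorphMn /= -mulr_natr divfK ?pnatr_eq0// => le_card.
rewrite (_ : [set i in _ | _] =
    [set j | t%:C < sing_val (M - E *m M *m E') j]); last first.
  by apply/setP => j; rewrite !inE -singular_valuesE ltcR.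
rewrite (leq_trans le_card)//.
set A := [set j | _].
rewrite -muln2 -[X in (_ * X)%N]card_bool -[in X in (_ * X)%N]cardsT.
rewrite -cardsX subset_leq_card//; apply/fintype.subsetP => -[j b].
by rewrite !inE andbT -singular_valuesE ltcR ltr_pdivrMr.
Qed.

End RealSingularValues.

(** * Partitions into joint level sets of integer codes *)

Section CodePartition.
Variables (X I : finType) (c : I -> X -> nat).

Definition code_partition : {set {set X}} :=
  preim_partition (fun x => [ffun i => c i x]) [set: X].

Lemma code_partitionP : finset.partition code_partition [set: X].
Proof. exact: preim_partitionP. Qed.

Lemma mem_pblock_code x y :
  (y \in finset.pblock code_partition x) = [forall i, c i x == c i y].
Proof.
rewrite pblock_equivalence_partition ?inE//; last by split=> // /eqP->.
apply/eqP/forallP => [/ffunP xy i|xy]; first by have := xy i; rewrite !ffunE => ->.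
by apply/ffunP => i; rewrite !ffunE; apply/eqP.
Qed.

End CodePartition.

(** * Entropy of a code partition *)

Section EntropyBound.
Variables (R : realType) (X : finType) (PX : X -> R).
Hypothesis PX_prob : is_prob PX.

Lemma prob_ge0 (A : {set X}) : 0 <= prob PX A.
Proof. by apply: sumr_ge0 => x _; apply: (proj1 PX_prob). Qed.

(** One term of Gibbs' inequality, from the tangent bound [ln (w / p) <= w / p - 1]. *)
Lemma mul_lnV_le (p w : R) : 0 <= p -> 0 < w ->
  p * ln p^-1 <= p * ln w^-1 + (w - p).
Proof.
rewrite le_eqVlt => /predU1P[<-|p0] w0.
  by rewrite !mul0r add0r subr0 ltW.
have : ln (w / p) <= w / p - 1.
  have := @le_ln1Dx R (w / p - 1); rewrite [1 + _]addrC subrK; apply.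
  by rewrite ltrBrDl subrr divr_gt0.
rewrite ln_div ?posrE// !lnV ?posrE// => le_ln.
rewrite -subr_ge0 (_ : _ - _ = p * (w / p - 1 - (ln w - ln p))).
  by rewrite mulr_ge0 ?subr_ge0// ltW.
by field; rewrite gt_eqF.
Qed.

Lemma geometric_half_le1 n : \sum_(j < n) (2^-1 : R) ^+ j.+1 <= 1.
Proof.
suff -> : \sum_(j < n) (2^-1 : R) ^+ j.+1 = 1 - 2^-1 ^+ n.
  by rewrite lerBlDr lerDl exprn_ge0.
elim: n => [|n IHn]; first by rewrite big_ord0 expr0 subrr.
by rewrite big_ord_recr /= IHn exprS; lra.
Qed.

(* Gibbs' inequality, against the weight [2 ^ - sum_i (c_i + 1)] on codes. *)
Lemma entropy_code_partition_le (I : finType) (c : I -> X -> nat) :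
  entropy PX (code_partition c) <= \sum_i (1 + \sum_x PX x * (c i x)%:R).
Proof.
set P := code_partition c; have Ppart := code_partitionP c.
have trT := transversalP Ppart; set T := transversal P _ in trT.
have PE : P = [set finset.pblock P x | x in T].
  by rewrite (pblock_transversal trT).
pose len x := (\sum_i (c i x).+1)%N.
pose w x : R := 2^-1 ^+ len x.
have w0 x : 0 < w x by rewrite exprn_gt0.
(* Kraft's inequality: distinct parts have distinct code tuples, so the sum is at most that over all
   tuples, a product of partial geometric series. The crude bound [N] puts the tuples in a finite
   type. *)
have sum_w : \sum_(x in T) w x <= 1.
  pose N := (\sum_i \sum_x c i x)%N.
  have cN i x : (c i x < N.+1)%N.
    by rewrite ltnS /N (bigD1 i)//= (bigD1 x)//= -addnA leq_addr.
  pose h x : {ffun I -> 'I_N.+1} := [ffun i => Ordinal (cN i x)].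
  pose W (k : {ffun I -> 'I_N.+1}) : R := \prod_i 2^-1 ^+ (k i).+1.
  have hinj : {in T &, injective h}.
    move=> x y xT yT /ffunP hxy; apply: (pblock_inj trT xT yT).
    apply: same_pblock; first by case/and3P: Ppart.
    rewrite mem_pblock_code; apply/forallP => i.
    by have := congr1 val (hxy i); rewrite !ffunE /= => ->.
  have -> : \sum_(x in T) w x = \sum_(k in [set h x | x in T]) W k.
    rewrite [RHS]big_imset//=; apply: eq_bigr => x _.
    rewrite /w /len /W expr_sum; apply: eq_bigr => i _.
    by rewrite ffunE.
  apply: (@le_trans _ _ (\sum_k W k)).
    rewrite [leRHS](bigID (mem [set h x | x in T]))/= lerDl sumr_ge0// => k _.
    by apply: prodr_ge0 => i _; rewrite exprn_ge0.
  rewrite -(bigA_distr_bigA (fun=> fun j : 'I_N.+1 => (2^-1 : R) ^+ j.+1)).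
  apply: prodr_ile1 => i _; rewrite geometric_half_le1 andbT.
  by apply: sumr_ge0 => j _; rewrite exprn_ge0.
have sumT (F : {set X} -> R) :
    \sum_(A in P) F A = \sum_(x in T) F (finset.pblock P x).
  by rewrite {1}PE big_imset//; apply: (pblock_inj trT).
have sumPX (F : X -> R) : \sum_x F x =
    \sum_(x in T) \sum_(y in finset.pblock P x) F y.
  rewrite -(sumT (fun A => \sum_(y in A) F y)) -(set_partition_big _ Ppart).
  by apply: eq_bigl => x; rewrite inE.
rewrite /entropy sumT.
apply: (@le_trans _ _ (\sum_(x in T) (prob PX (finset.pblock P x) * ln (w x)^-1
    + (w x - prob PX (finset.pblock P x))))).
  by apply: ler_sum => x _; rewrite mul_lnV_le// prob_ge0.
(* The corrections add up to the sum of [w] over [T] minus 1, which is at most 0 by [sum_w]. *)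
rewrite big_split /= sumrB /prob -sumPX (proj2 PX_prob).
rewrite -[leRHS]addr0 lerD ?subr_le0//.
apply: (@le_trans _ _ (\sum_(x in T) (\sum_(y in finset.pblock P x)
    PX y * (len y)%:R))).
  apply: ler_sum => x _; rewrite mulr_suml; apply: ler_sum => y.
  rewrite mem_pblock_code => /forallP xy.
  rewrite ler_wpM2l ?(proj1 PX_prob)//.
  have -> : len y = len x by apply: eq_bigr => i _; rewrite (eqP (xy i)).
  (* [ln 2 <= 1] bounds the logarithm of the inverse weight by the code length. *)
  rewrite /w -exprVn invrK lnXn// -[leRHS]mulr_natr mul1r -[leLHS]mulr_natr.
  rewrite ler_piMl// (_ : 2 = 1 + 1)// le_ln1Dx//; lra.
rewrite -sumPX.
rewrite (eq_bigr (fun x => \sum_i PX x * (c i x).+1%:R)) => [|x _]; last first.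
  by rewrite -mulr_sumr; congr (_ * _); exact: natr_sum.
rewrite exchange_big /=; apply: ler_sum => i _.
have -> : 1 + \sum_x PX x * (c i x)%:R = \sum_x (PX x + PX x * (c i x)%:R).
  by rewrite big_split /= (proj2 PX_prob).
by apply: ler_sum => x _; rewrite -natr1 mulrDr mulr1 addrC.
Qed.

End EntropyBound.

(** * Conditional expectation as a pair of orthogonal projections *)

Section Averaging.
Variables (R : realType).
Local Open Scope complex_scope.
Local Open Scope sesquilinear_scope.

Section OneSpace.
Variables (X : finType) (PX : X -> R) (P : {set {set X}}).
Hypothesis PX_prob : is_prob PX.
Hypothesis Ppart : finset.partition P [set: X].

Local Notation block := (finset.pblock P).

(** Kernel of the conditional expectation on [P], in the Euclidean coordinates
    [h x * Num.sqrt (PX x)] of a function [h]. *)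
Definition avg_kernel (x y : X) : R :=
  if y \in block x then Num.sqrt (PX x) * Num.sqrt (PX y) / prob PX (block x)
  else 0.

Definition avg_mx : 'M[R[i]]_#|X| :=
  \matrix_(i, j) (avg_kernel (enum_val i) (enum_val j))%:C.

Let PX_ge0 x : 0 <= PX x. Proof. exact: (proj1 PX_prob). Qed.

Lemma mem_block x : x \in block x.
Proof. by rewrite mem_pblock (cover_partition Ppart) inE. Qed.

Lemma eq_block x y : y \in block x -> block y = block x.
Proof. by move=> xy; apply: same_pblock xy; case/and3P: Ppart. Qed.

Lemma sum_enum_val (V : nmodType) (F : X -> V) :
  \sum_(i < #|X|) F (enum_val i) = \sum_x F x.
Proof. by rewrite -big_enum_val. Qed.

Lemma prob_block0 x : prob PX (block x) = 0 -> PX x = 0.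
Proof.
move/eqP; rewrite /prob psumr_eq0// => /allP/(_ x (mem_index_enum _)).
by rewrite mem_block => /eqP.
Qed.

Lemma avg_kernelC x y : avg_kernel x y = avg_kernel y x.
Proof.
rewrite /avg_kernel; have [xy|xy] := boolP (y \in block x).
  by rewrite (eq_block xy) mem_block [Num.sqrt (PX x) * _]mulrC.
by case: ifPn => // yx; rewrite (eq_block yx) mem_block in xy.
Qed.

Lemma sum_avg_kernel (h : X -> R[i]) x :
  (forall y, y \in block x -> h y = h x) ->
  \sum_y (avg_kernel x y)%:C * (h y * (Num.sqrt (PX y))%:C)
    = h x * (Num.sqrt (PX x))%:C.
Proof.
move=> hconst.
rewrite (eq_bigr (fun y => if y \in block x then
    h x * (Num.sqrt (PX x) / prob PX (block x))%:C * (PX y)%:C else 0)); last first.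
  move=> y _; rewrite /avg_kernel; case: ifP => [xy|_]; last by rewrite mul0r.
  rewrite hconst// -[in RHS](sqr_sqrtr (PX_ge0 y)) expr2 !rmorphM/=; ring.
rewrite -big_mkcond -mulr_sumr -rmorph_sum -mulrA -rmorphM /=; congr (_ * _%:C).
(* On a null block the inverse is 0, but then [PX x = 0] and both sides vanish. *)
have [p0|p0] := eqVneq (prob PX (block x)) 0; last by rewrite divfK.
by rewrite (prob_block0 p0) sqrtr0 !mul0r.
Qed.

Lemma avg_mx_fix (h : X -> R[i]) :
  (forall x y, y \in block x -> h y = h x) ->
  let w := \col_i (h (enum_val i) * (Num.sqrt (PX (enum_val i)))%:C) in
  avg_mx *m w = w.
Proof.
move=> hconst; apply/matrixP => i j; rewrite !mxE.
under eq_bigr => k _ do rewrite !mxE.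
rewrite (sum_enum_val (fun y => (avg_kernel (enum_val i) y)%:C *
  (h y * (Num.sqrt (PX y))%:C))).
by apply: sum_avg_kernel => y; apply: hconst.
Qed.

(** Idempotence holds because each column of the kernel is itself a weighted block-constant
    function, which averaging fixes. *)
Lemma avg_mx_orthoproj : orthoproj avg_mx.
Proof.
split; apply/matrixP => i j; rewrite !mxE.
  by rewrite avg_kernelC; apply: conjc_real.
under eq_bigr => k _ do rewrite !mxE.
rewrite (sum_enum_val (fun y => (avg_kernel (enum_val i) y)%:C *
  (avg_kernel y (enum_val j))%:C)).
set x := enum_val i; set z := enum_val j.
pose h y : R[i] := (if z \in block y then Num.sqrt (PX z) / prob PX (block y)
  else 0)%:C.
have hE y : (avg_kernel y z)%:C = h y * (Num.sqrt (PX y))%:C.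
  rewrite -rmorphM /avg_kernel; case: ifP => _; last by rewrite mul0r.
  by congr _%:C; ring.
under eq_bigr => y _ do rewrite hE.
rewrite hE; apply: sum_avg_kernel => y xy.
by rewrite /h (eq_block xy).
Qed.

End OneSpace.

(** Carries the problem over to matrices. Each point weight inside the average is the square of its
    root: one root goes to the weighted entry of [f], the other to the kernel. No probability is
    cancelled, so null parts fit in. *)
Lemma weighted_mx_cond_exp (X Y : finType) (PX : X -> R) (PY : Y -> R) f P Q :
  is_prob PX -> is_prob PY ->
  finset.partition P [set: X] -> finset.partition Q [set: Y] ->
  weighted_mx PX PY (cond_exp PX PY f P Q)
    = avg_mx PX P *m weighted_mx PX PY f *m avg_mx PY Q.
Proof.
move=> PX_prob PY_prob Ppart Qpart; apply/matrixP => i j; rewrite !mxE.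
under eq_bigr => k _.
  rewrite !mxE; under eq_bigr => l _ do rewrite !mxE.
  rewrite (sum_enum_val (fun x => (avg_kernel PX P (enum_val i) x)%:C *
    (f (x, enum_val k) * (Num.sqrt (PX x * PY (enum_val k)))%:C))).
  over.
rewrite (sum_enum_val (fun y => (\sum_x (avg_kernel PX P (enum_val i) x)%:C *
    (f (x, y) * (Num.sqrt (PX x * PY y))%:C)) *
    (avg_kernel PY Q y (enum_val j))%:C)).
move: (enum_val i) (enum_val j) => x y {i j}.
rewrite /cond_exp /=; set A := finset.pblock P x; set B := finset.pblock Q y.
have [[p pE] [p' pE']] : (exists p, p = prob PX A) /\ (exists p, p = prob PY B).
  by split; [exists (prob PX A) | exists (prob PY B)].
rewrite -pE -pE' exchange_big mulr_suml mulr_suml [LHS]big_mkcond /=.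
apply: eq_bigr => y' _; rewrite avg_kernelC// /avg_kernel -/B -pE'.
case: ifP => _; last by rewrite mulr0.
rewrite !mulr_suml [LHS]big_mkcond; apply: eq_bigr => x' _.
rewrite -/A -pE; case: ifP => _; last by rewrite !mul0r.
rewrite !sqrtrM ?(proj1 PX_prob)//.
rewrite -{1}(sqr_sqrtr (proj1 PX_prob x')) -{1}(sqr_sqrtr (proj1 PY_prob y')).
rewrite !expr2 !rmorphM !fmorphV invfM /=; ring.
Qed.

Lemma weighted_mxB (X Y : finType) (PX : X -> R) (PY : Y -> R) f g :
  weighted_mx PX PY (fun z => f z - g z)
    = weighted_mx PX PY f - weighted_mx PX PY g.
Proof. by apply/matrixP => i j; rewrite !mxE mulrBl. Qed.

End Averaging.

(** * Low-entropy partitions that nearly fix given vectors *)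

Section Quantization.
Variables (R : realType).
Local Open Scope complex_scope.
Local Open Scope sesquilinear_scope.

(* [truncn] is [0] on negative reals, so this rounds [t] towards [0] and is
   determined by two natural numbers. *)
Definition quantum (t : R) : R := (Num.truncn t)%:R - (Num.truncn (- t))%:R.

Lemma quantum_dist t : `|t - quantum t| <= 1.
Proof.
wlog t0 : t / 0 <= t => [H|].
  have [/H//|t0] := leP 0 t.
  rewrite -normrN opprB (_ : _ - _ = - t - quantum (- t)); last first.
    by rewrite /quantum opprK; ring.
  by apply: H; rewrite oppr_ge0 ltW.
have -> : quantum t = (Num.truncn t)%:R.
  rewrite /quantum; suff -> : Num.truncn (- t) = 0%N by rewrite subr0.
  by apply/truncn0Pn; rewrite -ltNge (le_lt_trans _ ltr01)// oppr_le0.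
have /andP[le_t lt_t] := truncn_itv t0.
by rewrite ger0_norm ?subr_ge0// lerBlDr addrC natr1 ltW.
Qed.

Lemma truncn_le_norm (t : R) : (Num.truncn t)%:R <= `|t|.
Proof.
have [t0|t0] := leP 0 t; first by rewrite ger0_norm// truncn_le.
have -> : Num.truncn t = 0%N by apply/truncn0Pn; rewrite -ltNge (lt_trans t0).
by [].
Qed.

(** The contraction [1 - E] kills [w'], so averaging approximates [w] at least as well as any fixed
    vector does. *)
Lemma vnorm_avg_le (X : finType) (PX : X -> R) (P : {set {set X}})
    (w w' : 'cV[R[i]]_#|X|) :
  is_prob PX -> finset.partition P [set: X] -> avg_mx PX P *m w' = w' ->
  vnorm (w - avg_mx PX P *m w) <= vnorm (w - w').
Proof.
move=> PX_prob Ppart w'E; have Eo := avg_mx_orthoproj PX_prob Ppart.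
have -> : w - avg_mx PX P *m w = (1%:M - avg_mx PX P) *m (w - w').
  by rewrite mulmxBl mul1mx mulmxBr w'E opprB addrA subrK.
by have := orthoproj_contract (orthoprojC Eo) (w - w'); rewrite mul1r.
Qed.

Section Family.
Variables (X I : finType) (PX : X -> R) (w : I -> 'cV[R[i]]_#|X|) (S eta : R).
Hypothesis PX_prob : is_prob PX.
Hypothesis S_ge0 : 0 <= S.
Hypothesis eta_gt0 : 0 < eta.
Hypothesis w_le : forall i, vnorm (w i) <= S%:C.
Hypothesis w_supp : forall i k, PX (enum_val k) = 0 -> w i k 0 = 0.

Let PX_ge0 x : 0 <= PX x. Proof. exact: (proj1 PX_prob). Qed.

(** The function on [X] whose weighted vector is [w i]. At null points division by 0 gives 0, in
    agreement with [w_supp]. *)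
Let u i x : R[i] := w i (enum_rank x) 0 / (Num.sqrt (PX x))%:C.

Let wE i k : w i k 0 = u i (enum_val k) * (Num.sqrt (PX (enum_val k)))%:C.
Proof.
rewrite /u enum_valK; have [p0|p0] := eqVneq (PX (enum_val k)) 0.
  by rewrite w_supp// p0 !mul0r.
by rewrite divfK// eq_complex /= eqxx andbT sqrtr_eq0 -ltNge lt_def p0 PX_ge0.
Qed.

Let part (b : bool) (z : R[i]) : R := if b then complex.Re z else complex.Im z.

Let part_sqr b z : part b z ^+ 2 <= complex.Re z ^+ 2 + complex.Im z ^+ 2.
Proof. by case: b; rewrite /= ?lerDl ?lerDr sqr_ge0. Qed.

(* [p.1] selects a vector, [p.2.1] its real or imaginary part, [p.2.2] a sign. *)
Let code (p : I * (bool * bool)) x : nat :=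
  Num.truncn ((-1) ^+ p.2.2 * (part p.2.1 (u p.1 x) / (eta * S))).

Let P := code_partition code.

Let sum_u_sqr i : \sum_x PX x * (complex.Re (u i x) ^+ 2 + complex.Im (u i x) ^+ 2)
  <= S ^+ 2.
Proof.
have := w_le i; rewrite -ler_sqr ?nnegrE ?vnorm_ge0 ?ler0c//.
rewrite vnorm_sqr -rmorphXn /= => le_S.
rewrite -lecR; apply: le_trans le_S.
rewrite rmorph_sum -(sum_enum_val (fun x => (PX x *
  (complex.Re (u i x) ^+ 2 + complex.Im (u i x) ^+ 2))%:C)) /=.
apply: ler_sum => k _; rewrite wE normrM exprMn -add_Re2_Im2.
rewrite rmorphM mulrC normc_def /= expr0n addr0 sqrtr_sqr -rmorphXn /=.
by rewrite real_normK ?num_real// sqr_sqrtr.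
Qed.

Let entropy_P : entropy PX P <= #|I|%:R * (4 * (1 + 2 / eta)).
Proof.
apply: (le_trans (entropy_code_partition_le PX_prob _)).
apply: (@le_trans _ _ (\sum_(p : I * (bool * bool)) (1 + 2 / eta))); last first.
  by rewrite sumr_const !card_prod card_bool -[leLHS]mulr_natl natrM -mulrA.
apply: ler_sum => p _; rewrite lerD2l.
(* The bound [|t| <= 1 + t ^+ 2] at [t = a / S], with [a] the chosen part of [u], lets the second
   moment control the mean code, whence [2 / eta]. *)
have code_le x : PX x * (code p x)%:R <=
    eta^-1 * (PX x + PX x * (complex.Re (u p.1 x) ^+ 2
      + complex.Im (u p.1 x) ^+ 2) * (S^-1) ^+ 2).
  rewrite -[X in X + _]mulr1 -mulrA -mulrDr [leRHS]mulrCA ler_wpM2l//.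
  apply: (le_trans (truncn_le_norm _)).
  rewrite normrM normrX normrN1 expr1n mul1r invfM mulrCA normrM.
  rewrite ger0_norm ?invr_ge0 ?(ltW eta_gt0)// ler_wpM2l ?invr_ge0 ?(ltW eta_gt0)//.
  set a := part _ _; have aP := part_sqr p.2.1 (u p.1 x).
  apply: (@le_trans _ _ (1 + (a / S) ^+ 2)).
    have [le1|lt1] := leP `|a / S| 1; last first.
      rewrite -[leLHS]add0r lerD// -[(a / S) ^+ 2]real_normK ?num_real// expr2.
      by rewrite ler_peMl// ltW.
    by rewrite ler_wpDr ?sqr_ge0.
  by rewrite lerD2l exprMn ler_wpM2r// sqr_ge0.
apply: (le_trans (ler_sum _ (fun x _ => code_le x))).
rewrite -mulr_sumr mulrC ler_wpM2r ?invr_ge0 ?(ltW eta_gt0)//.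
rewrite big_split /= (proj2 PX_prob) (_ : 2 = 1 + 1)// lerD2l -mulr_suml.
have [S0|S0] := eqVneq S 0; first by rewrite S0 invr0 expr0n mulr0.
rewrite exprVn ler_pdivrMr ?mul1r ?sum_u_sqr// exprn_gt0//.
by rewrite lt_def S0.
Qed.

Let avg_P i : vnorm (w i - avg_mx PX P *m w i) <= (2 * eta * S)%:C.
Proof.
(* [h] rounds both parts of [u i] to multiples of [eta * S]. The four codes of [i] determine it, so
   it is constant on each part of [P]. *)
pose h x : R[i] := (eta * S)%:C *
  (quantum (complex.Re (u i x) / (eta * S)) +i*
   quantum (complex.Im (u i x) / (eta * S))).
have hconst x y : y \in finset.pblock P x -> h y = h x.
  rewrite mem_pblock_code => /forallP xy; rewrite /h /quantum.
  have := (eqP (xy (i, (true, false))), eqP (xy (i, (true, true))),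
    eqP (xy (i, (false, false))), eqP (xy (i, (false, true)))).
  by rewrite /code /= !expr0 !expr1 !mul1r !mulN1r => -[[[-> ->] ->] ->].
have := avg_mx_fix PX_prob (code_partitionP _) hconst.
set w' := \col_k _ => /= w'E.
apply: le_trans (vnorm_avg_le _ PX_prob (code_partitionP _) w'E) _.
have S2 : 0 <= 2 * eta * S by rewrite !mulr_ge0// ltW.
rewrite -ler_sqr ?nnegrE ?vnorm_ge0 ?ler0c// vnorm_sqr -rmorphXn /=.
(* If [S = 0] the rounding bound fails, but then [w i] itself is 0. *)
have dist t : `|t - eta * S * quantum (t / (eta * S))| <= eta * S \/ S = 0.
  have [->|S0] := eqVneq S 0; [by right|left].
  have aS : 0 < eta * S by rewrite mulr_gt0// lt_def S0.
  rewrite -{1}[t](divfK (lt0r_neq0 aS)) mulrC -mulrBr normrM gtr0_norm//.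
  by rewrite ler_piMr ?quantum_dist// ltW.
have term k : `|(w i - w') k 0| ^+ 2 <= (PX (enum_val k) * (2 * eta * S) ^+ 2)%:C.
  set x := enum_val k.
  have [S0|S0] := eqVneq S 0.
    have w0 : w i = 0.
      apply: vnorm_eq0; apply/le_anti; rewrite vnorm_ge0 andbT.
      by have := w_le i; rewrite S0.
    rewrite !mxE w0 mxE /h S0 mulr0 !mul0r subr0 normr0 expr0n ler0c.
    by rewrite mulr_ge0// sqr_ge0.
  rewrite mxE [(- w') _ _]mxE [w' _ _]mxE wE -/x -mulrBl normrM exprMn.
  rewrite -add_Re2_Im2 -add_Re2_Im2 /= expr0n addr0 sqr_sqrtr//.
  rewrite -rmorphM /= lecR mulrC ler_wpM2l//.
  have sqr_dist t : (t - eta * S * quantum (t / (eta * S))) ^+ 2 <= (eta * S) ^+ 2.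
    case: (dist t) => [le_t|S00]; last by rewrite S00 eqxx in S0.
    by rewrite -[leLHS]real_normK ?num_real// ler_sqr ?nnegrE// mulr_ge0// ltW.
  apply: (@le_trans _ _ ((eta * S) ^+ 2 + (eta * S) ^+ 2)).
    rewrite lerD//.
      have := sqr_dist (complex.Re (u i x)); congr (_ ^+ 2 <= _).
      by rewrite /h; case: (u i x) => a b /=; rewrite mul0r subr0.
    have := sqr_dist (complex.Im (u i x)); congr (_ ^+ 2 <= _).
    by rewrite /h; case: (u i x) => a b /=; rewrite mul0r addr0.
  by rewrite -mulrA exprMn; have := sqr_ge0 (eta * S); lra.
apply: (le_trans (ler_sum _ (fun k _ => term k))).
rewrite (sum_enum_val (fun x => (PX x * (2 * eta * S) ^+ 2)%:C)) -rmorph_sum /=.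
by rewrite -mulr_suml (proj2 PX_prob) mul1r.
Qed.

Lemma exists_quantizing_partition : exists P : {set {set X}},
  [/\ finset.partition P [set: X],
      entropy PX P <= #|I|%:R * (4 * (1 + 2 / eta)) &
      forall i, vnorm (w i - avg_mx PX P *m w i) <= (2 * eta * S)%:C].
Proof. by exists P; split => //; exact: code_partitionP. Qed.

End Family.
End Quantization.

(** * Interpolation between the operator norm and the [q]-norm *)

Section Interpolation.
Variable R : realType.

Lemma lq_norm_ge0 n (q : R) (s : 'rV[R]_n) : 0 <= lq_norm q%:E s.
Proof. exact: powR_ge0. Qed.

Lemma lq_norm_powR n (q : R) (s : 'rV[R]_n) : 0 < q -> (forall j, 0 <= s 0 j) ->
  lq_norm q%:E s `^ q = \sum_j s 0 j `^ q.
Proof.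
move=> q0 s0; rewrite /= -powRrM mulVf ?gt_eqF// powRr1.
  by apply: eq_bigr => j _; rewrite ger0_norm.
by apply: sumr_ge0 => j _; rewrite powR_ge0.
Qed.

Lemma le_lq_norm n (q : R) (s : 'rV[R]_n) j : 0 < q -> (forall j, 0 <= s 0 j) ->
  s 0 j <= lq_norm q%:E s.
Proof.
move=> q0 s0; rewrite leNgt; apply/negP => lt_s.
have := gt0_ltr_powR q0 _ _ lt_s; rewrite !nnegrE lq_norm_ge0 s0 => /(_ isT isT).
rewrite lq_norm_powR// (bigD1 j)//= ltNge lerDl => /negP; apply.
by apply: sumr_ge0 => k _; rewrite powR_ge0.
Qed.

Lemma powR_le1 (a x : R) : 0 < a <= 1 -> 0 <= x -> a `^ x <= 1.
Proof. by move=> a01 x0; have := ger_powR a01 x0; rewrite powRr0. Qed.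

(* The scale is chosen so that [(6 d) ^ (r - q) * 2 ^ (q + 1) = eps ^ r]. *)
Lemma interpolation_scale (q : R) (r : \bar R) : 1 <= q -> (q%:E < r)%E ->
  exists c b : R, [/\ 0 < c, c <= 1, 0 < b &
    forall eps S : R, 0 < eps -> eps < 1 -> 0 <= S ->
    forall n (s : 'rV[R]_n), (forall j, 0 <= s 0 j) ->
    (forall j, s 0 j <= 6 * (c * eps `^ b) * S) ->
    \sum_j s 0 j `^ q <= 2 `^ (q + 1) * S `^ q ->
    lq_norm r s <= eps * S].
Proof.
move=> q1; have q0 : 0 < q by apply: lt_le_trans q1.
case: r => [r|_|//]; last first.
  (* For [r = +oo] the uniform bound on the entries is already the claim, [6^-1] cancelling the
     6. *)
  exists 6^-1, 1; split; [lra|lra|lra|move=> eps S eps0 eps1 S0 n s s0 sS _ /=].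
  apply/bigmax_leP; split=> [|j _]; first by rewrite mulr_ge0// ltW.
  by rewrite ger0_norm// (le_trans (sS j))// (powRr1 (ltW eps0)); lra.
rewrite lte_fin => qr; have rq0 : 0 < r - q by rewrite subr_gt0.
have r0 : 0 < r by apply: lt_trans qr.
pose c := 2 `^ (- ((q + 1) / (r - q))) / 6.
exists c, (r / (r - q)); split.
- by rewrite divr_gt0// powR_gt0.
- rewrite ler_pdivrMr// mul1r powRN (@le_trans _ _ 1)// ?ler1n//.
  rewrite invf_le1 ?powR_gt0//; have := @ler_powR R 2; rewrite ler1n.
  move=> /(_ isT 0 ((q + 1) / (r - q))); rewrite powRr0; apply.
  by rewrite divr_ge0 ?(ltW rq0)//; lra.
- by rewrite divr_gt0.
move=> eps S eps0 eps1 S0 n s s0 sS sq /=.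
set d := c * _ in sS.
have d6 : (6 * d) `^ (r - q) * 2 `^ (q + 1) = eps `^ r.
  have -> : 6 * d = 2 `^ (- ((q + 1) / (r - q))) * eps `^ (r / (r - q)).
    by rewrite /d /c; field.
  rewrite powRM ?powR_ge0// -!powRrM divfK ?gt_eqF// mulNr divfK ?gt_eqF//.
  by rewrite powRN mulrAC mulVf ?mul1r// gt_eqF ?powR_gt0.
have d0 : 0 <= 6 * d by rewrite !mulr_ge0// ?powR_ge0// divr_ge0// powR_ge0.
have sum_le : \sum_j `|s 0 j| `^ r <= (eps * S) `^ r.
  (* Split [s ^ r] as [s ^ (r - q) * s ^ q]: the uniform bound handles the first factor, the [q]-sum
     the second. *)
  apply: (@le_trans _ _ (\sum_j (6 * d * S) `^ (r - q) * s 0 j `^ q)).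
    apply: ler_sum => j _; rewrite ger0_norm//.
    have -> : s 0 j `^ r = s 0 j `^ (r - q) * s 0 j `^ q.
      by rewrite -powRD subrK// gt_eqF.
    rewrite ler_wpM2r ?powR_ge0// ge0_ler_powR ?nnegrE//; first exact: ltW.
    by rewrite mulr_ge0.
  rewrite -mulr_sumr (le_trans (ler_wpM2l _ sq)) ?powR_ge0//.
  rewrite (powRM _ d0 S0) (powRM _ (ltW eps0) S0) -d6.
  have -> : S `^ r = S `^ (r - q) * S `^ q by rewrite -powRD subrK// gt_eqF.
  by rewrite le_eqVlt; apply/orP; left; apply/eqP; ring.
rewrite -[leRHS]powRr1 ?mulr_ge0 ?(ltW eps0)// -(mulfV (lt0r_neq0 r0)) powRrM.
apply: ge0_ler_powR sum_le; rewrite ?nnegrE ?invr_ge0 ?(ltW r0) ?powR_ge0//.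
by apply: sumr_ge0 => j _; rewrite powR_ge0.
Qed.

End Interpolation.

(** * Regularity at a fixed scale *)

Section Regularity.
Variable R : realType.
Local Open Scope complex_scope.
Local Open Scope sesquilinear_scope.
Variables (X Y : finType) (PX : X -> R) (PY : Y -> R) (f : X * Y -> R[i]).
Hypothesis PX_prob : is_prob PX.
Hypothesis PY_prob : is_prob PY.

Local Notation M := (weighted_mx PX PY f).

Lemma weighted_mulmx_supp (z : 'cV[R[i]]_#|Y|) k :
  PX (enum_val k) = 0 -> (M *m z) k 0 = 0.
Proof.
move=> p0; rewrite mxE big1// => l _.
by rewrite mxE p0 mul0r sqrtr0 mulr0 mul0r.
Qed.

(** In [s ^+ 2 *: v = M ^t* *m M *m v] the rows of [M ^t*] at null points are zero, while [s] is
    not. This is the support condition for quantizing [v]. *)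
Lemma weighted_sing_vec_supp j k : 0 < sing_val M j ->
  PY (enum_val k) = 0 -> sing_vec M j k 0 = 0.
Proof.
move=> s0 p0; apply: (mulfI (lt0r_neq0 (exprn_gt0 2 s0))); rewrite mulr0.
have /matrixP/(_ k 0) := gram_sing_vec M j; rewrite [RHS]mxE => <-.
rewrite -mulmxA mxE big1// => l _.
by rewrite !mxE p0 mulr0 sqrtr0 mulr0 rmorph0 mul0r.
Qed.

(** Markov's inequality for [q]-th powers; if the Schatten norm is 0, all singular values vanish and
    the set is empty. *)
Lemma card_sing_val_schatten (q d : R) : 0 < q -> 0 < d ->
  #|[set j | (d * schatten_norm PX PY q%:E f)%:C < sing_val M j]|%:R
    <= d `^ (- q).
Proof.
move=> q0 d0; set S := schatten_norm _ _ _ _; set J := [set j | _].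
have s0 j := singular_values_ge0 M j.
have S0 : 0 <= S by apply: lq_norm_ge0.
have [SE|S_neq0] := eqVneq S 0.
  rewrite (_ : J = finset.set0) ?cards0 ?powR_ge0//.
  apply/setP => j; rewrite !inE -singular_valuesE ltcR SE mulr0.
  by apply/negbTE; rewrite -leNgt -SE; apply: le_lq_norm.
have Sgt0 : 0 < S by rewrite lt_def S_neq0.
have : #|J|%:R * (d * S) `^ q <= S `^ q.
  rewrite mulr_natl -sumr_const lq_norm_powR//.
  rewrite [leRHS](bigID (mem J))/= -[leLHS]addr0 lerD ?sumr_ge0//; last first.
    by move=> j _; rewrite powR_ge0.
  apply: ler_sum => j; rewrite inE -singular_valuesE ltcR => /ltW le_s.
  by rewrite ge0_ler_powR ?nnegrE ?mulr_ge0// ltW.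
rewrite powRM ?(ltW d0)// mulrA (ger_pMl _ (powR_gt0 q Sgt0)) powRN.
by rewrite -ler_pdivlMr ?powR_gt0// mul1r.
Qed.

(* Singular values below [d * S] are absorbed in the error; the at most
   [d ^ - q] others have singular vectors that are averaged at precision
   [d ^ (q + 1)]. *)
Lemma regularity_at_scale (q d : R) : 1 <= q -> 0 < d -> d <= 1 ->
  let S := schatten_norm PX PY q%:E f in
  exists (P : {set {set X}}) (Q : {set {set Y}}),
    let s := singular_values
      (weighted_mx PX PY (fun z => f z - cond_exp PX PY f P Q z)) in
    [/\ finset.partition P [set: X], finset.partition Q [set: Y],
        entropy PX P <= 12 * d `^ (- (2 * q + 1)),
        entropy PY Q <= 12 * d `^ (- (2 * q + 1)) &
        (forall j, s 0 j <= 6 * d * S) /\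
        \sum_j s 0 j `^ q <= 2 `^ (q + 1) * S `^ q].
Proof.
move=> q1 d0 d1 S; have q0 : 0 < q by apply: lt_le_trans q1.
have S0 : 0 <= S by apply: lq_norm_ge0.
have dS0 : 0 <= d * S by rewrite mulr_ge0// ltW.
set J := [set j | (d * S)%:C < sing_val M j].
have cardJ : #|J|%:R <= d `^ (- q) by apply: card_sing_val_schatten.
have sJ (i : 'I_#|J|) : (d * S)%:C < sing_val M (enum_val i).
  by have := enum_valP i; rewrite inE.
pose eta := d `^ (q + 1).
have eta0 : 0 < eta by rewrite powR_gt0.
have eta1 : eta <= 1.
  by apply: powR_le1; rewrite ?d0//; lra.
have sS j : sing_val M j <= S%:C.
  rewrite -singular_valuesE lecR; apply: le_lq_norm => // k.
  exact: singular_values_ge0.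
have Mv_le (i : 'I_#|J|) : vnorm (M *m sing_vec M (enum_val i)) <= S%:C.
  by rewrite vnorm_mulmx_sing_vec.
have v_le (i : 'I_#|J|) : vnorm (sing_vec M (enum_val i)) <= 1%:C.
  by rewrite vnorm_sing_vec.
have Mv_supp (i : 'I_#|J|) := @weighted_mulmx_supp (sing_vec M (enum_val i)).
have v_supp (i : 'I_#|J|) k :
    PY (enum_val k) = 0 -> sing_vec M (enum_val i) k 0 = 0.
  by apply: weighted_sing_vec_supp; apply: le_lt_trans (sJ i); rewrite ler0c.
(* [P] serves the vectors [M *m v], of norm at most [S], and [Q] the unit vectors [v]. *)
have [P [Ppart P_ent P_avg]] :=
  exists_quantizing_partition PX_prob S0 eta0 Mv_le Mv_supp.
have [Q [Qpart Q_ent Q_avg]] :=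
  exists_quantizing_partition PY_prob ler01 eta0 v_le v_supp.
(* As [eta <= 1], the factor [1 + 2 / eta] is at most [3 / eta], and [4 * 3 = 12]. *)
have ent_le : #|'I_#|J| |%:R * (4 * (1 + 2 / eta)) <= 12 * d `^ (- (2 * q + 1)).
  rewrite card_ord (_ : - (2 * q + 1) = - q + - (q + 1)); last by ring.
  rewrite powRD; last by apply/implyP => _; rewrite gt_eqF.
  have eta_inv : 1 <= eta^-1 by rewrite invf_ge1.
  rewrite (powRN d (q + 1)) -/eta.
  have : #|J|%:R * (1 + 2 / eta) <= d `^ (- q) * (3 * eta^-1).
    by rewrite ler_pM//; lra.
  by lra.
exists P, Q; split => //; [exact: le_trans ent_le|exact: le_trans ent_le|].
rewrite weighted_mxB weighted_mx_cond_exp//.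
have Eo := avg_mx_orthoproj PX_prob Ppart.
have Eo' := avg_mx_orthoproj PY_prob Qpart.
split=> [j|]; last first.
  rewrite lq_norm_powR//; last exact: singular_values_ge0.
  exact: sum_singular_values_compress.
apply: singular_values_le; first by rewrite -mulrA mulr_ge0.
have dSC : 0 <= (d * S)%:C :> R[i] by rewrite ler0c.
apply: opbound_le (opbound_sing_compress M dSC Eo Eo').
rewrite (eq_bigl (fun j => j \in J)); last by move=> k; rewrite inE.
(* Each large singular value costs at most [2 * eta * S] on either side. Since [#|J| * eta <= d],
   the total is at most [2 * d * S + 4 * d * S]. *)
apply: (@le_trans _ _ ((d * S)%:C *+ 2 + \sum_(i < #|J|) (4 * eta * S)%:C)).
  rewrite lerD2l big_enum_val /=; apply: ler_sum => i _.
  apply: (le_trans (lerD (P_avg i) (ler_pM _ _ (sS _) (Q_avg i)))).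
  - exact: sing_val_ge0.
  - exact: vnorm_ge0.
  by rewrite -rmorphM -rmorphD /= lecR; lra.
rewrite sumr_const card_ord -!rmorphMn -rmorphD /= lecR.
rewrite -[X in _ + X <= _]mulr_natl -mulr_natr.
have : #|J|%:R * eta <= d.
  rewrite (le_trans (ler_wpM2r (ltW eta0) cardJ))// /eta -powRD; last first.
    by apply/implyP => _; rewrite gt_eqF.
  by rewrite addKr powRr1// ltW.
by move=> /(ler_wpM2r S0); lra.
Qed.

End Regularity.

(** * Choice of the constants and conclusion *)

Local Open Scope complex_scope.

Theorem theorem1p1 (R : realType) (q r : \bar R)
    (hq : (1 <= q)%E) (hqr : (q < r)%E) :
  exists A B : R, 0 < A /\ 0 < B /\
    forall (X Y : finType) (PX : X -> R) (PY : Y -> R)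
      (hPX : is_prob PX) (hPY : is_prob PY)
      (f : X * Y -> R[i]) (eps : R) (heps0 : 0 < eps) (heps1 : eps < 1),
    exists (P : {set {set X}}) (Q : {set {set Y}}),
      [/\ finset.partition P [set: X], finset.partition Q [set: Y],
          entropy PX P <= A * eps `^ (- B),
          entropy PY Q <= A * eps `^ (- B) &
          schatten_norm PX PY r (fun z => f z - cond_exp PX PY f P Q z)
            <= eps * schatten_norm PX PY q f].
Proof.
case: q hq hqr => [q hq hqr|_|//]; last by case: r.
rewrite lee_fin in hq.
have [c [b [c0 c1 b0 scale]]] := interpolation_scale hq hqr.
have e0 : 0 < 2 * q + 1 by lra.
(* At the scale [d = c * eps ^ b] the entropy bound [12 * d ^ (- (2 * q + 1))] factors into these
   constants. *)
exists (12 * c `^ (- (2 * q + 1))), (b * (2 * q + 1)); split; last split.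
- by rewrite mulr_gt0// powR_gt0.
- by rewrite mulr_gt0.
move=> X Y PX PY hPX hPY f eps eps0 eps1.
have d0 : 0 < c * eps `^ b by rewrite mulr_gt0// powR_gt0.
have d1 : c * eps `^ b <= 1.
  rewrite mulr_ile1 ?powR_ge0 ?(ltW c0)//.
  by rewrite powR_le1 ?eps0 ?(ltW eps1)// ltW.
have [P [Q [Ppart Qpart P_ent Q_ent [sS sq]]]] :=
  regularity_at_scale f hPX hPY hq d0 d1.
have scaleE : 12 * (c * eps `^ b) `^ (- (2 * q + 1)) =
    12 * c `^ (- (2 * q + 1)) * eps `^ (- (b * (2 * q + 1))).
  by rewrite powRM ?powR_ge0 ?(ltW c0)// -powRrM mulrN mulrA.
rewrite scaleE in P_ent Q_ent.
exists P, Q; split => //.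
apply: (scale eps _ eps0 eps1) => //; first exact: lq_norm_ge0.
by move=> j; apply: singular_values_ge0.
Qed.
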